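(* Let $(X,\tau,\mathfrak a)$ be an aura topological space. The map $$\Phi_{\mathfrak a}:\mathsf L_{\mathfrak a}(X)\longrightarrow\tau_{\mathfrak a},\qquad \Phi_{\mathfrak a}([A])=K_{\mathfrak a}(A),$$ is an order isomorphism, where $\tau_{\mathfrak a}$ is ordered by inclusion. Consequently, $\mathsf L_{\mathfrak a}(X)$ is a complete frame.
   Context: $X$ is a nonempty set. An aura topological space is a triple $(X,\tau,\mathfrak a)$ where $(X,\tau)$ is a topological space and $\mathfrak a:X\to\tau$ (the scope function) satisfies $x\in\mathfrak a(x)$ for every $x\in X$. A set $U\subseteq X$ is $\mathfrak a$-open (aura-open) if $\{x\in U:\mathfrak a(x)\subseteq U\}=U$; the family of all $\mathfrak a$-open sets is denoted $\tau_{\mathfrak a}$ and is known to be a topology on $X$. For $A,B\subseteq X$, $A\equiv_{\mathfrak a}B$ means that for every $U\in\tau_{\mathfrak a}$, $A\subseteq U\iff B\subseteq U$. The canonical hull is $K_{\mathfrak a}(A)=\bigcap\{U\in\tau_{\mathfrak a}:A\subseteq U\}$. One has $A\equiv_{\mathfrak a}B$ iff $K_{\mathfrak a}(A)=K_{\mathfrak a}(B)$. $\mathsf L_{\mathfrak a}(X)=\mathcal P(X)/{\equiv_{\mathfrak a}}$ is the set of equivalence classes $[A]$ of subsets $A\subseteq X$, ordered by $[A]\le[B]\iff K_{\mathfrak a}(A)\subseteq K_{\mathfrak a}(B)$ (this is well defined). A complete frame is a complete lattice in which binary meets distribute over arbitrary joins. *)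

(* Defs.v *)
From HB Require Import structures.
From mathcomp Require Import all_boot all_order.
From mathcomp Require Import all_classical topology.

Set Implicit Arguments.
Unset Strict Implicit.
Unset Printing Implicit Defensive.

Import Order.TTheory.
Local Open Scope classical_set_scope.
Local Open Scope quotient_scope.

(* A scope function X -> tau on (X, tau), i.e. the datum turning the
   topological space X into an aura topological space. *)
Record aura (X : topologicalType) := Aura {
  scope_of :> X -> set X;
  scope_open : forall x, open (scope_of x);
  scope_mem : forall x, scope_of x x }.

Section AuraOpen.
Variables (X : topologicalType) (a : aura X).
Implicit Types A B U : set X.

Definition aura_open U : Prop := [set x | U x /\ a x `<=` U] = U.

Definition aura_topology : set (set X) := [set U | aura_open U].

Definition aura_hull A : set X :=
  \bigcap_(U in [set U | aura_topology U /\ A `<=` U]) U.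

Definition aura_equiv A B : Prop :=
  forall U, aura_topology U -> (A `<=` U <-> B `<=` U).

Lemma aura_hull_open A : aura_topology (aura_hull A).
Proof.
rewrite /aura_topology /= /aura_open; apply/seteqP; split => [x []//|x Kx].
split=> // y axy U [oU AU]; have := Kx U (conj oU AU).
by move: (oU); rewrite /= /aura_open => {1}<- [_]; apply.
Qed.

Lemma sub_aura_hull A : A `<=` aura_hull A.
Proof. by move=> x Ax U [_]; apply. Qed.

Lemma aura_hull_subP A U : aura_topology U -> (A `<=` U <-> aura_hull A `<=` U).
Proof.
move=> oU; split=> [AU x Kx|]; first exact: Kx.
exact: subset_trans (@sub_aura_hull A).
Qed.

Lemma aura_equivP A B : aura_equiv A B <-> aura_hull A = aura_hull B.
Proof.
split=> [AB|AB U oU]; last first.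
  by rewrite (aura_hull_subP A oU) (aura_hull_subP B oU) AB.
rewrite /aura_hull; congr bigcap; apply/seteqP.
by split=> U [oU] /(AB _ oU).
Qed.

Definition aura_equivb : rel (set X) := fun A B => `[< aura_equiv A B >].

Lemma aura_equivb_refl : reflexive aura_equivb.
Proof. by move=> A; apply/asboolP/aura_equivP. Qed.

Lemma aura_equivb_sym : symmetric aura_equivb.
Proof. by move=> A B; apply/asboolP/asboolP => /aura_equivP/esym/aura_equivP. Qed.

Lemma aura_equivb_trans : transitive aura_equivb.
Proof.
move=> B A C /asboolP/aura_equivP AB /asboolP/aura_equivP BC.
by apply/asboolP/aura_equivP; rewrite AB.
Qed.

Canonical aura_equiv_rel :=
  EquivRel aura_equivb aura_equivb_refl aura_equivb_sym aura_equivb_trans.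

Definition aura_quot := {eq_quot aura_equiv_rel}.
HB.instance Definition _ := Choice.on aura_quot.
HB.instance Definition _ := EqQuotient.on aura_quot.

Definition aura_class (A : set X) : aura_quot := \pi A.

Lemma aura_classP A B : aura_class A = aura_class B <-> aura_equiv A B.
Proof.
split=> [/eqquotP/asboolP//|AB].
exact/eqquotP/asboolP.
Qed.

Lemma aura_hull_repr A : aura_hull (repr (aura_class A)) = aura_hull A.
Proof. by apply/aura_equivP/aura_classP; rewrite /aura_class reprK. Qed.

Definition le_aura_quot (p q : aura_quot) : bool :=
  `[< aura_hull (repr p) `<=` aura_hull (repr q) >].

Lemma le_aura_quot_refl : reflexive le_aura_quot.
Proof. by move=> p; apply/asboolP. Qed.

Lemma le_aura_quot_anti : antisymmetric le_aura_quot.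
Proof.
move=> p q /andP[/asboolP pq /asboolP qp].
rewrite -[p]reprK -[q]reprK; apply/aura_classP/aura_equivP.
exact/seteqP.
Qed.

Lemma le_aura_quot_trans : transitive le_aura_quot.
Proof.
move=> q p r /asboolP pq /asboolP qr; apply/asboolP.
exact: subset_trans pq qr.
Qed.

Fact aura_display : Order.disp_t. Proof. exact: Order.Disp tt tt. Qed.

HB.instance Definition _ := Order.Le_isPOrder.Build aura_display aura_quot
  le_aura_quot_refl le_aura_quot_anti le_aura_quot_trans.

(* The order does not depend on the representatives chosen by repr. *)
Lemma le_aura_classE A B :
  (aura_class A <= aura_class B)%O <-> aura_hull A `<=` aura_hull B.
Proof.
by split=> [/asboolP|AB]; last apply/asboolP; rewrite !aura_hull_repr.
Qed.

(* tau_a as a type, with the order inherited from `<=` on set X. *)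
Definition aura_opens : Type := set_type aura_topology.
HB.instance Definition _ := SubChoice.on aura_opens.
HB.instance Definition _ := [SubChoice_isSubPOrder of aura_opens by <: with aura_display].

Lemma le_aura_opensE (U V : aura_opens) : (U <= V)%O <-> val U `<=` val V.
Proof. by rewrite -subsetEset. Qed.

Definition aura_Phi (p : aura_quot) : aura_opens :=
  exist _ (aura_hull (repr p)) (mem_set (aura_hull_open (repr p))).

End AuraOpen.

Section OrderNotions.
Context {d d' : Order.disp_t}.

Definition order_isomorphism (P : porderType d) (Q : porderType d')
    (f : P -> Q) : Prop :=
  bijective f /\ {mono f : x y / (x <= y)%O}.

Definition complete_lattice (L : porderType d) : Prop :=
  forall S : set L, supremums S !=set0 /\ infimums S !=set0.

(* x /\ (\/ S) = \/ {x /\ s | s in S}, with joins and meets expressed as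
   suprema and infima in the poset L. *)
Definition meet_distributes_over_joins (L : porderType d) : Prop :=
  forall (x : L) (S : set L) (j m : L),
    supremums S j -> infimums [set x; j] m ->
    supremums [set y | exists2 s, S s & infimums [set x; s] y] m.

Definition complete_frame (L : porderType d) : Prop :=
  complete_lattice L /\ meet_distributes_over_joins L.

End OrderNotions.

(* Main.v *)
Require Import Defs.
From mathcomp Require Import all_boot all_order.
From mathcomp Require Import all_classical topology.

(** A set [U] is aura-open exactly when it is saturated: it contains the whole
    scope [a x] of each of its points [x].  Saturation is preserved by arbitrary
    unions and also by arbitrary intersections, so the aura topology is an
    Alexandrov topology, whose joins and meets are set-theoretic unions and
    intersections; the frame law on open sets is then the distributivity of
    intersection over union ([aura_opens_complete_frame]).

    The hull map embeds the quotient in the open sets because the order of the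
    quotient is by definition inclusion of hulls, and it is onto because an open
    set is its own hull ([aura_hull_id]).  Being an order isomorphism
    ([aura_Phi_order_isomorphism]), it carries the frame structure back to the
    quotient: suprema and infima depend on the order only
    ([complete_frame_order_isomorphism]). *)

Local Open Scope classical_set_scope.

(** * Transport of complete frames along order isomorphisms *)

Section Transport.
Set Implicit Arguments.
Unset Strict Implicit.
Context {d d' : Order.disp_t} {P : porderType d} {Q : porderType d'}.
Variables (f : P -> Q) (fiso : order_isomorphism f).

Lemma ubound_order_isomorphism (S : set P) p :
  ubound (f @` S) (f p) <-> ubound S p.
Proof.
have [_ fmono] := fiso.
split=> [ub x Sx|ub _ [x Sx <-]]; last by rewrite fmono; exact: ub.
by rewrite -fmono; apply: ub; exists x.
Qed.

Lemma lbound_order_isomorphism (S : set P) p :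
  lbound (f @` S) (f p) <-> lbound S p.
Proof.
have [_ fmono] := fiso.
split=> [lb x Sx|lb _ [x Sx <-]]; last by rewrite fmono; exact: lb.
by rewrite -fmono; apply: lb; exists x.
Qed.

Lemma supremums_order_isomorphism (S : set P) p :
  supremums (f @` S) (f p) <-> supremums S p.
Proof.
have [[g fK gK] fmono] := fiso.
split=> -[/ubound_order_isomorphism ub least]; split=> //.
  by move=> q /ubound_order_isomorphism/least; rewrite fmono.
by move=> q; rewrite -[q]gK => /ubound_order_isomorphism/least; rewrite fmono.
Qed.

Lemma infimums_order_isomorphism (S : set P) p :
  infimums (f @` S) (f p) <-> infimums S p.
Proof.
have [[g fK gK] fmono] := fiso.
split=> -[/lbound_order_isomorphism lb greatest]; split=> //.
  by move=> q /lbound_order_isomorphism/greatest; rewrite fmono.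
by move=> q; rewrite -[q]gK => /lbound_order_isomorphism/greatest;
  rewrite fmono.
Qed.

Lemma infimums2_order_isomorphism x y p :
  infimums [set f x; f y] (f p) <-> infimums [set x; y] p.
Proof. by rewrite -infimums_order_isomorphism image_setU !image_set1. Qed.

(** Completeness and the frame law are phrased through suprema and infima
    alone, so each piece of data is pushed forward by [f]; the one point to
    check is that the family of meets [x /\ s] is mapped onto the family of
    meets [f x /\ f s], which uses surjectivity of [f]. *)
Lemma complete_frame_order_isomorphism : complete_frame Q -> complete_frame P.
Proof.
have [[g fK gK] _] := fiso.
move=> [complQ distrQ]; split=> [S|x S j m supj infm].
  have [[u supu] [l infl]] := complQ (f @` S).
  split; [exists (g u); apply/supremums_order_isomorphism
         |exists (g l); apply/infimums_order_isomorphism]; by rewrite gK.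
apply/supremums_order_isomorphism.
have -> : f @` [set y | exists2 s, S s & infimums [set x; s] y] =
    [set z | exists2 t, (f @` S) t & infimums [set f x; t] z].
  apply/seteqP; split=> z.
    move=> [y [s Ss infy] <-]; exists (f s); first by exists s.
    exact/infimums2_order_isomorphism.
  move=> [_ [s Ss <-]]; rewrite -[z]gK => /infimums2_order_isomorphism infz.
  by exists (g z) => //; exists s.
apply: (distrQ _ _ (f j)); first exact/supremums_order_isomorphism.
exact/infimums2_order_isomorphism.
Qed.

End Transport.

(** * Aura-open sets as an Alexandrov topology *)

Section AuraFrame.
Set Implicit Arguments.
Unset Strict Implicit.
Variables (X : topologicalType) (a : aura X).
Implicit Types (U V W : aura_opens a) (S : set (aura_opens a)).

(** Saturation is the usable form of openness: being a closure condition on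
    points, it is visibly stable under unions and intersections. *)
Lemma aura_topologyP (A : set X) :
  aura_topology a A <-> forall x, A x -> a x `<=` A.
Proof.
split=> [oA x|sat]; last by apply/seteqP; split=> [x []|x Ax]; [|split; auto].
by rewrite -{1}oA => -[].
Qed.

Lemma aura_hull_id (A : set X) : aura_topology a A -> aura_hull a A = A.
Proof.
move=> oA; apply/seteqP; split; last exact: sub_aura_hull.
by rewrite -(aura_hull_subP _ oA).
Qed.

Lemma aura_opens_bigcup S : aura_topology a (\bigcup_(U in S) val U).
Proof.
apply/aura_topologyP => x [U SU Ux] y axy; exists U => //.
by move/aura_topologyP: (set_valP U) => /(_ x Ux); exact.
Qed.

Lemma aura_opens_bigcap S : aura_topology a (\bigcap_(U in S) val U).
Proof.
apply/aura_topologyP => x Sx y axy U SU.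
by move/aura_topologyP: (set_valP U) => /(_ x (Sx U SU)); exact.
Qed.

(** The union is open, hence a supremum among the open sets; by antisymmetry
    it is the only one.  The same reasoning applies to intersections, where an
    arbitrary topology would require taking the interior. *)
Lemma supremums_aura_opens S U :
  supremums S U <-> val U = \bigcup_(V in S) val V.
Proof.
pose W : aura_opens a := SigSub (mem_set (aura_opens_bigcup S)).
have supW : supremums S W.
  split=> [V SV|V ubV]; apply/le_aura_opensE; first exact: bigcup_sup.
  by apply: bigcup_sub => T ST; apply/le_aura_opensE; exact: ubV.
split=> [supU|UE]; first by rewrite (is_subset1_supremums supU supW).
by have -> : U = W by exact: val_inj.
Qed.

Lemma infimums_aura_opens S U :
  infimums S U <-> val U = \bigcap_(V in S) val V.
Proof.
pose W : aura_opens a := SigSub (mem_set (aura_opens_bigcap S)).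
have infW : infimums S W.
  split=> [V SV|V lbV]; apply/le_aura_opensE; first exact: bigcap_inf.
  by apply: sub_bigcap => T ST; apply/le_aura_opensE; exact: lbV.
split=> [infU|UE]; first by rewrite (is_subset1_infimums infU infW).
by have -> : U = W by exact: val_inj.
Qed.

Lemma infimums2_aura_opens U V W :
  infimums [set U; V] W <-> val W = val U `&` val V.
Proof. by rewrite infimums_aura_opens bigcap_setU !bigcap_set1. Qed.

Lemma aura_opens_complete_frame : complete_frame (aura_opens a).
Proof.
split=> [S|U S J M].
  split; first by exists (SigSub (mem_set (aura_opens_bigcup S)));
    apply/supremums_aura_opens.
  by exists (SigSub (mem_set (aura_opens_bigcap S))); apply/infimums_aura_opens.
move=> /supremums_aura_opens JE /infimums2_aura_opens ME.
apply/supremums_aura_opens; rewrite ME JE setI_bigcupr; apply/seteqP; split.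
  move=> x [V SV UVx].
  (* The union runs over open sets only, so [U] meet [V] must be one of them. *)
  pose W : aura_opens a :=
    SigSub (mem_set (aura_opens_bigcap [set U; V])).
  have WE : val W = val U `&` val V by rewrite /= bigcap_setU !bigcap_set1.
  exists W; last by rewrite WE.
  by exists V => //; apply/infimums2_aura_opens.
by move=> x [W [V SV /infimums2_aura_opens ->] UVx]; exists V.
Qed.

(** * The hull isomorphism *)

(** The inverse sends an open set to its class.  One composite is the identity
    because a set and its hull have the same hull, the other because an open
    set is its own hull. *)
Lemma aura_Phi_order_isomorphism : order_isomorphism (@aura_Phi X a).
Proof.
split; last first.
  by move=> p q; apply/idP/idP => [/le_aura_opensE pq|/asboolP pq];
    [apply/asboolP|apply/le_aura_opensE].
exists (fun U => aura_class a (val U)) => [p|U].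
  rewrite -[RHS]reprK; apply/aura_classP/aura_equivP.
  exact: aura_hull_id (aura_hull_open _ _).
apply: val_inj; rewrite /= aura_hull_repr.
exact: aura_hull_id (set_valP U).
Qed.

End AuraFrame.

Theorem theorem5p1 (X : topologicalType) (hX : [set: X] !=set0) (a : aura X) :
  [/\ forall A : set X, \val (aura_Phi (aura_class a A)) = aura_hull a A,
      order_isomorphism (@aura_Phi X a)
    & complete_frame (aura_quot a)].
Proof.
split; first exact: aura_hull_repr.
  exact: aura_Phi_order_isomorphism.
apply: complete_frame_order_isomorphism (aura_Phi_order_isomorphism a) _.
exact: aura_opens_complete_frame.
Qed.
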